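(* Let $n\ge3$ be odd and define $a\in C(\mathbb{KP}_n)$ by $a=\sum_{l\in\mathbb Z_n}\cos\left(\frac{2l\pi}n\right)\rho_l^+$ (i.e. $a_{\rho_l^+}=\cos(\frac{2l\pi}{n})$ for every $l\in\mathbb Z_n$, and all other coefficients of $a$ on irreducible characters are $0$). Then $\mathcal F(a)$ is a state on $C(\mathbb{KP}_n)$ such that, for any $c\ge0$, if $k=e^cn^2$ (a positive integer), then $$\frac12e^{-k\left(\frac{\pi^2}{2n^2}+\frac{\pi^4}{4n^4}\right)}\le\left\lVert\mathcal F(a)^{\star k}-\int_{\mathbb{KP}_n}\right\rVert_{QTV}\le e^{-k\frac{\pi^2}{2n^2}}.$$ Moreover, the lower bound still holds when $k=e^{-c}n^2$ (a positive integer) with $c\ge 0$.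
   Context: Sekine quantum group $\mathbb{KP}_n$ ($n\ge2$). Put $\eta=e^{2\imath\pi/n}$; all indices are taken modulo $n$. $C(\mathbb{KP}_n)=\bigoplus_{i,j\in\mathbb Z_n}\mathbb C e_{(i,j)}\oplus M_n(\mathbb C)$ as a $*$-algebra, where the $e_{(i,j)}$ are the units of the one-dimensional summands and $E_{i,j}$ ($1\le i,j\le n$) are matrix units of $M_n(\mathbb C)$. The coproduct is $\Delta(e_{(i,j)})=\sum_{s,t\in\mathbb Z_n}e_{(s,t)}\otimes e_{(i-s,j-t)}+\frac1n\sum_{m,r=1}^n\eta^{i(m-r)}E_{m,r}\otimes E_{m+j,r+j}$, $\Delta(E_{i,j})=\sum_{s,t\in\mathbb Z_n}\eta^{s(i-j)}e_{(-s,-t)}\otimes E_{i-t,j-t}+\sum_{s,t\in\mathbb Z_n}\eta^{s(j-i)}E_{i-t,j-t}\otimes e_{(s,t)}$. The Haar state is $\int_{\mathbb{KP}_n}\big(\sum x_{(i,j)}e_{(i,j)}+\sum X_{i,j}E_{i,j}\big)=\frac1{2n^2}\big(\sum_{i,j}x_{(i,j)}+n\sum_iX_{i,i}\big)$. For $x\in C(\mathbb{KP}_n)$, $\mathcal F(x)$ is the linear functional $y\mapsto\int_{\mathbb{KP}_n}yx$. The convolution of functionals is $\phi\star\psi=(\phi\otimes\psi)\circ\Delta$, and $\phi^{\star k}$ is the $k$-fold convolution power. A state is a positive unital linear functional. $\lVert\phi-\psi\rVert_{QTV}=\sup\{|\phi(p)-\psi(p)|: p\in C(\mathbb{KP}_n)\text{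 a projection}\}$. $\rho_l^+=\sum_{i,j\in\mathbb Z_n}\eta^{il}e_{(i,j)}+\sum_{m=1}^nE_{m,m+l}$ for $l\in\mathbb Z_n$ (a one-dimensional irreducible representation of $\mathbb{KP}_n$). *)

(* Defs.v *)
From HB Require Import structures.
From mathcomp Require Import all_boot all_order all_algebra.
From mathcomp Require Import all_classical all_reals all_analysis.
From mathcomp Require Import complex.
Set Implicit Arguments.
Unset Strict Implicit.
Unset Printing Implicit Defensive.
Import Order.TTheory GRing.Theory Num.Theory.
Local Open Scope ring_scope.

(* All indices live in 'Z_n, which is the ring of integers modulo n only when
   2 <= n.  The matrix units are accordingly indexed by 'Z_n rather than by
   1, ..., n (index n being 0); 'Z_n is 'I_(Zp_trunc n).+2 by definition, so
   the matrix block below is M_n(C) for 2 <= n.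
   The ring and module structures on pairs, on {ffun _ -> _} (pointwise) and
   on square matrices make KP R n the direct sum of algebras
   C^(n^2) (+) M_n(C). *)
Notation KP R n :=
  ({ffun 'Z_n * 'Z_n -> R[i]} * 'M[R[i]]_((Zp_trunc n).+2))%type.

(* The two summands of the index set of the basis (e_(i,j)), (E_(i,j)). *)
Notation KPidx n := (('Z_n * 'Z_n) + ('Z_n * 'Z_n))%type.

(* C(KP_n) (x) C(KP_n), by coordinates in the tensor square of that basis. *)
Notation KP2 R n := {ffun KPidx n * KPidx n -> R[i]}.

Notation KPfun R n := {linear KP R n -> R[i] | *%R}.

Section Sekine.
Variables (R : realType) (n : nat).
Implicit Types (x y p : KP R n) (t : KP2 R n) (phi psi : KPfun R n).

Definition eta : R[i] :=
  (cos (2 * pi / n%:R) +i* sin (2 * pi / n%:R))%C.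

(* The exponent is a representative in {0, ..., n-1}; eta ^+ n = 1. *)
Definition etaX (k : 'Z_n) : R[i] := eta ^+ (k : nat).

Definition KPe (i j : 'Z_n) : KP R n := ([ffun ij => (ij == (i, j))%:R], 0).
Definition KPE (i j : 'Z_n) : KP R n := (0, delta_mx i j).

Definition KPstar x : KP R n :=
  ([ffun ij => Num.conj (x.1 ij)], (map_mx Num.conj x.2)^T).

Definition KPbasis (b : KPidx n) : KP R n :=
  match b with inl ij => KPe ij.1 ij.2 | inr ij => KPE ij.1 ij.2 end.

Definition KPcoord (b : KPidx n) x : R[i] :=
  match b with inl ij => x.1 ij | inr ij => x.2 ij.1 ij.2 end.

Definition tens x y : KP2 R n := [ffun b => KPcoord b.1 x * KPcoord b.2 y].

Definition tensf phi psi t : R[i] :=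
  \sum_b t b * (phi (KPbasis b.1) * psi (KPbasis b.2)).

Definition Delta_e (i j : 'Z_n) : KP2 R n :=
  \sum_(s : 'Z_n) \sum_(t : 'Z_n) tens (KPe s t) (KPe (i - s) (j - t))
  + n%:R^-1 *: \sum_(m : 'Z_n) \sum_(r : 'Z_n)
      etaX (i * (m - r)) *: tens (KPE m r) (KPE (m + j) (r + j)).

Definition Delta_E (i j : 'Z_n) : KP2 R n :=
  \sum_(s : 'Z_n) \sum_(t : 'Z_n)
     etaX (s * (i - j)) *: tens (KPe (- s) (- t)) (KPE (i - t) (j - t))
  + \sum_(s : 'Z_n) \sum_(t : 'Z_n)
     etaX (s * (j - i)) *: tens (KPE (i - t) (j - t)) (KPe s t).

Definition Delta x : KP2 R n :=
  \sum_(i : 'Z_n) \sum_(j : 'Z_n) x.1 (i, j) *: Delta_e i j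
  + \sum_(i : 'Z_n) \sum_(j : 'Z_n) x.2 i j *: Delta_E i j.

Definition haar x : R[i] :=
  (2 * n%:R ^+ 2)^-1 *
  (\sum_(i : 'Z_n) \sum_(j : 'Z_n) x.1 (i, j) + n%:R * \sum_(i : 'Z_n) x.2 i i).

Definition fourier x := fun y : KP R n => haar (y * x).

Definition conv phi psi := fun y : KP R n => tensf phi psi (Delta y).

Definition counit := fun y : KP R n => y.1 (0, 0).

Fact haar_is_linear : linear_for *%R haar.
Proof.
move=> a x y; rewrite /haar.
transitivity ((2 * n%:R ^+ 2)^-1 *
  (a * (\sum_(i : 'Z_n) \sum_(j : 'Z_n) x.1 (i, j)
        + n%:R * \sum_(i : 'Z_n) x.2 i i)
   + (\sum_(i : 'Z_n) \sum_(j : 'Z_n) y.1 (i, j)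
      + n%:R * \sum_(i : 'Z_n) y.2 i i))); last first.
  by rewrite mulrDr mulrCA.
congr (_ * _); rewrite mulrDr (mulrCA a) addrACA -mulrDr; congr (_ + _ * _).
  rewrite mulr_sumr -big_split; apply: eq_bigr => i _.
  by rewrite mulr_sumr -big_split; apply: eq_bigr => j _; rewrite !ffunE.
by rewrite mulr_sumr -big_split; apply: eq_bigr => i _; rewrite !mxE.
Qed.
HB.instance Definition _ :=
  GRing.isLinear.Build R[i] (KP R n) R[i] *%R haar haar_is_linear.

Fact fourier_is_linear x : linear_for *%R (fourier x).
Proof.
move=> a y z; rewrite /fourier mulrDl.
suff -> : a *: y * x = a *: (y * x) by rewrite linearP.
congr pair; last exact/esym/scalemxAl.
by apply/ffunP => ij; rewrite !ffunE scalerAl.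
Qed.
HB.instance Definition _ x :=
  GRing.isLinear.Build R[i] (KP R n) R[i] *%R (fourier x) (fourier_is_linear x).

Fact Delta_is_linear : linear Delta.
Proof.
move=> a x y; rewrite /Delta scalerDr addrACA; congr (_ + _).
  rewrite scaler_sumr -big_split; apply: eq_bigr => i _.
  rewrite scaler_sumr -big_split; apply: eq_bigr => j _.
  by rewrite !ffunE scalerDl scalerA.
rewrite scaler_sumr -big_split; apply: eq_bigr => i _.
rewrite scaler_sumr -big_split; apply: eq_bigr => j _.
by rewrite !mxE scalerDl scalerA.
Qed.
HB.instance Definition _ :=
  GRing.isLinear.Build R[i] (KP R n) (KP2 R n) *:%R Delta Delta_is_linear.

Fact conv_is_linear phi psi : linear_for *%R (conv phi psi).
Proof.
move=> a y z; rewrite /conv linearP /tensf mulr_sumr -big_split.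
by apply: eq_bigr => b _; rewrite !ffunE mulrDl -mulrA.
Qed.
HB.instance Definition _ phi psi :=
  GRing.isLinear.Build R[i] (KP R n) R[i] *%R (conv phi psi)
    (conv_is_linear phi psi).

Fact counit_is_linear : linear_for *%R counit.
Proof. by move=> a y z; rewrite /counit !ffunE. Qed.
HB.instance Definition _ :=
  GRing.isLinear.Build R[i] (KP R n) R[i] *%R counit counit_is_linear.

(* phi * (phi * ... * phi) with k factors; the counit for k = 0. *)
Definition convX phi (k : nat) : KPfun R n :=
  iterop k (fun f g : KPfun R n => conv f g : KPfun R n) phi (counit : KPfun R n).

Definition is_state phi := (forall x, 0 <= phi (KPstar x * x)) /\ phi 1 = 1.

Definition is_projection p := KPstar p = p /\ p * p = p.

(* The supremum is taken in the extended reals, so that no boundedness side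
   condition is needed. *)
Definition qtv phi psi : \bar R :=
  ereal_sup [set (complex.Re `|phi p - psi p|)%:E | p in [set p | is_projection p]].

Definition rho_plus (l : 'Z_n) : KP R n :=
  \sum_(i : 'Z_n) \sum_(j : 'Z_n) etaX (i * l) *: KPe i j
  + \sum_(m : 'Z_n) KPE m (m + l).

Lemma KP_expand x : x = \sum_b KPcoord b x *: KPbasis b.
Proof.
rewrite big_sumType /=.
have -> : \sum_(ij : 'Z_n * 'Z_n) x.1 ij *: KPe ij.1 ij.2 = (x.1, 0) :> KP R n.
  rewrite [LHS]surjective_pairing !raddf_sum /=; congr pair; last first.
    by apply: big1 => ij _; rewrite scaler0.
  apply/ffunP => ij; rewrite sum_ffunE (bigD1 ij) //= !ffunE -surjective_pairing.
  rewrite eqxx [_ *: _]mulr1 big1 ?addr0 // => kl ij_kl.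
  by rewrite !ffunE -surjective_pairing eq_sym (negPf ij_kl) scaler0.
have -> : \sum_(ij : 'Z_n * 'Z_n) x.2 ij.1 ij.2 *: KPE ij.1 ij.2
    = (0, x.2) :> KP R n.
  rewrite [LHS]surjective_pairing !raddf_sum /=; congr pair.
    by apply: big1 => ij _; rewrite scaler0.
  rewrite [RHS]matrix_sum_delta.
  by rewrite (pair_bigA _ (fun i j => x.2 i j *: delta_mx i j)).
by case: x => x1 x2 /=; congr pair; rewrite ?addr0 ?add0r.
Qed.

Lemma tensf_tens phi psi x y : tensf phi psi (tens x y) = phi x * psi y.
Proof.
rewrite {2}(KP_expand x) {2}(KP_expand y) !linear_sum /= big_distrlr /=.
rewrite (pair_bigA _ (fun b c => phi _ * psi _)) /=; apply: eq_bigr => b _.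
by rewrite ffunE !linearZ /= mulrACA.
Qed.

End Sekine.

(* Main.v *)
(* The functionals phi_l = F(rho_l^+) are orthogonal idempotents for the
   convolution and phi_0 is the Haar state, so with a_l = cos(2 l pi / n),
   F(a)^k - haar = sum_(l <> 0) a_l^k phi_l = F(b), where
   b = sum_(l <> 0) a_l^k rho_l^+.
   State: a is self-adjoint and a^2 = (n / 2) a, so that by traciality
   haar(x^* x a) = (2 / n) haar((x a)^* (x a)) >= 0.
   Upper bound: for a projection p, haar(p b) = haar((p - 1/2) b), and
   (p - 1/2)^2 = 1/4, so Cauchy-Schwarz bounds it by half the square root of
   haar(b^2) = sum_(l <> 0) a_l^(2k); doubling is a bijection of Z_n for odd n,
   so the a_l^2 are the cos(j pi / n)^2, and cos x <= exp(- x^2 / 2) on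
   [0, pi/2] makes the sum geometric once k >= n^2.
   Lower bound: b acts on both summands through the values
   g(i) = sum_(l <> 0) a_l^k eta^(il); the spectral projection p of b for
   g >= 0 gives haar(p b) = (1 / n) sum_(g(i) >= 0) g(i), which is half the mean
   of |g| because g has mean zero, hence at least |a_l|^k / 2 by Fourier
   inversion.  Take l = (n - 1) / 2, for which |a_l| = cos(pi / n). *)

Require Import Defs.
From mathcomp Require Import all_boot all_order all_algebra.
From mathcomp Require Import all_classical all_reals all_analysis.
From mathcomp Require Import complex.
From mathcomp Require Import ring lra zify.
Set Implicit Arguments.
Unset Strict Implicit.
Unset Printing Implicit Defensive.
Import Order.TTheory GRing.Theory Num.Theory.
Import numFieldNormedType.Exports.
Local Open Scope ring_scope.

(** * Cosine estimates *)

(** By the mean value theorem. The inequalities below use it on auxiliary functions [f] whose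
    derivative has an evident sign. *)
Lemma nondecreasing_from_0 (R : realType) (f df : R -> R) (b : R) : 0 <= b ->
  (forall x : R, is_derive x 1 f (df x)) ->
  (forall x, 0 <= x <= b -> 0 <= df x) -> f 0 <= f b.
Proof.
move=> b0 fdf df0; have [|c] := @MVT_segment R f df 0 b b0.
  by apply: derivable_within_continuous => x _; exact: ex_derive.
by rewrite in_itv/= => /df0 dfc; rewrite subr0 => fE; rewrite -subr_ge0 fE mulr_ge0.
Qed.

Lemma sin_le_id (R : realType) (x : R) : 0 <= x -> sin x <= x.
Proof.
move=> x0; pose f : R -> R := id - @sin R.
have : f 0 <= f x; last by rewrite /f !fctE/= sin0 subr0 subr_ge0.
by apply: (@nondecreasing_from_0 R f (fun y => 1 - cos y)) => // y _;
  rewrite subr_ge0 cos_le1.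
Qed.

(** Half-angle formula cos x = 1 - 2 sin(x/2)^2 combined with |sin h| <= h. *)
Lemma cos_ge_parabola (R : realType) (x : R) : 0 <= x -> 1 - x ^+ 2 / 2 <= cos x.
Proof.
move=> x0; have h0 : 0 <= x / 2 by rewrite divr_ge0.
have -> : cos x = 1 - 2 * sin (x / 2) ^+ 2.
  by rewrite -[in LHS](_ : (x / 2) *+ 2 = x) ?cos_mulr2n ?cos2sin2; lra.
have /andP[] : - (x / 2) <= sin (x / 2) <= x / 2.
  rewrite sin_le_id// andbT.
  (* Up to pi the sine is nonnegative; beyond pi >= 2 the bound sin >= -1 suffices. *)
  have [h|h] := leP (x / 2) pi.
    by apply: (@le_trans _ _ 0); [lra | rewrite sin_ge0_pi// h0].
  by apply: le_trans (sin_geN1 _); have := pi_ge2 R; lra.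
by move=> ? ?; nra.
Qed.

Lemma x_cos_le_sin (R : realType) (x : R) : 0 <= x <= pi -> x * cos x <= sin x.
Proof.
move=> /andP[x0 xpi]; pose f : R -> R := @sin R - id * @cos R.
have : f 0 <= f x; last by rewrite /f !fctE/= sin0 mul0r subr0 subr_ge0.
apply: (@nondecreasing_from_0 R f (fun y => y * sin y)) => // y.
  by apply: is_derive_eq; rewrite /GRing.scale/=; ring.
by move=> /andP[y0 yx]; rewrite mulr_ge0// sin_ge0_pi// y0 (le_trans yx).
Qed.

(** The product cos x * exp(x^2 / 2) starts at 1 and decreases on [0, pi], since its derivative is
    (x cos x - sin x) exp(x^2 / 2). The function [f] is its opposite. *)
Lemma cos_le_gauss (R : realType) (x : R) : 0 <= x <= pi ->
  cos x <= expR (- (x ^+ 2 / 2)).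
Proof.
move=> /andP[x0 xpi].
pose f : R -> R := - (@cos R * (expR \o (2^-1 \*: id ^+ 2 : R -> R))).
have : f 0 <= f x; last first.
  rewrite /f !fctE/= /GRing.scale/= cos0 expr0n/= mulr0 expR0 mulr1 lerN2.
  by move=> h; rewrite expRN -[leRHS]div1r ler_pdivlMr ?expR_gt0// [_ / 2]mulrC.
have df (y : R) :
    is_derive y 1 f ((sin y - y * cos y) * expR (2^-1 * y ^+ 2)).
  by apply: is_derive_eq; rewrite /= !fctE /GRing.scale/=; field.
apply: (nondecreasing_from_0 x0 df) => y.
move=> /andP[y0 yx]; rewrite mulr_ge0 ?expR_ge0// subr_ge0 x_cos_le_sin//.
by rewrite y0 (le_trans yx).
Qed.

Lemma expR_ge_quadratic (R : realType) (x : R) : 0 <= x ->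
  1 + x + x ^+ 2 / 2 <= expR x.
Proof.
move=> x0; pose f : R -> R := expR - (cst 1 + id + 2^-1 \*: id ^+ 2).
have : f 0 <= f x; last first.
  rewrite /f !fctE/= /GRing.scale/= expR0 expr0n/= mulr0 !addr0 subrr subr_ge0.
  by rewrite [_ / 2]mulrC.
have df (y : R) : is_derive y 1 f (expR y - (1 + y)).
  by apply: is_derive_eq; rewrite /GRing.scale/=; field.
apply: (nondecreasing_from_0 x0 df) => y.
by move=> _; rewrite subr_ge0 expR_ge1Dx.
Qed.

(** The triple angle formula at pi / 3 gives 4 c^3 - 3 c + 1 = (c + 1) (2 c - 1)^2 = 0, and c >
    0. *)
Lemma cos_pi_third (R : realType) : cos (pi / 3) = 2^-1 :> R.
Proof.
set c := cos _; have c0 : 0 < c.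
  by apply: cos_gt0_pihalf; have := pi_gt0 R; lra.
have : cos (pi / 3 + (pi / 3) *+ 2) = -1 :> R.
  by rewrite -cospi; congr cos; field.
rewrite cosD cos_mulr2n sin_mulr2n -/c => h.
have s2 := sin2cos2 (pi / 3 : R); rewrite -/c in s2.
have : (c + 1) * (2 * c - 1) ^+ 2 = 0 by nra.
move/eqP; rewrite mulf_eq0 sqrf_eq0 => /orP[|] /eqP; lra.
Qed.

(** With x = pi / n and u = x^2 / 2 + x^4 / 4, the claim is 1 <= cos x * exp u. For n >= 4 one has x
    <= 1, and the truncations 1 - x^2 / 2 and 1 + u + u^2 / 2 suffice. For n = 3, where x > 1, the
    exact value cos x = 1/2 is used. *)
Lemma cos_pi_div_ge (R : realType) (n : nat) : (3 <= n)%N ->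
  expR (- (pi ^+ 2 / (2 * n%:R ^+ 2) + pi ^+ 4 / (4 * n%:R ^+ 4)))
    <= cos (pi / n%:R) :> R.
Proof.
move=> n3; have n0 : (n%:R : R) != 0 by rewrite pnatr_eq0 -lt0n (leq_trans _ n3).
have -> : pi ^+ 2 / (2 * n%:R ^+ 2) + pi ^+ 4 / (4 * n%:R ^+ 4)
  = (pi / n%:R) ^+ 2 / 2 + (pi / n%:R) ^+ 4 / 4 :> R by field.
have pin0 : 0 <= pi / n%:R :> R by rewrite divr_ge0// pi_ge0.
set x := pi / n%:R in pin0 *; set u : R := _ + _.
have u0 : 0 <= u by rewrite addr_ge0// divr_ge0// exprn_ge0.
rewrite expRN -[leLHS]div1r ler_pdivrMr ?expR_gt0//.
have eu := expR_ge_quadratic u0.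
have cx := cos_ge_parabola pin0.
have [n4|] := leqP 4 n.
  have x1 : x <= 1.
    rewrite ler_pdivrMr ?mul1r ?ltr0n ?(leq_trans _ n3)//.
    have : (4 : R) <= n%:R by rewrite (ler_nat _ 4).
    by have := pihalf_lt2 R; lra.
  have y1 : 0 <= x ^+ 2 <= 1 by rewrite exprn_ge0// exprn_ile1.
  rewrite /u (_ : x ^+ 4 = (x ^+ 2) ^+ 2) in eu *; last by ring.
  move: (x ^+ 2) y1 u0 cx eu => y /andP[y0 y1] _ cx.
  set v := expR _; set w := (X in X <= v -> _) => eu.
  apply: (@le_trans _ _ ((1 - y / 2) * w)).
    (* For 0 <= y <= 1 the cofactor of y^2 is at least 1/8 - 1/16 - 1/32 - 1/64 = 1/64. *)
    have -> : (1 - y / 2) * w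
      = 1 + y ^+ 2 * (8^-1 - y / 16 - y ^+ 2 / 32 - y ^+ 3 / 64).
      by rewrite /w; field.
    rewrite lerDl mulr_ge0// ?sqr_ge0//.
    have : y ^+ 2 <= 1 by rewrite exprn_ile1.
    have : y ^+ 3 <= 1 by rewrite exprn_ile1.
    lra.
  apply: ler_pM => //; first lra.
  by rewrite /w; apply: addr_ge0; [|apply: divr_ge0]; nra.
rewrite ltnS => n3'; have nE : n = 3%N by apply/eqP; rewrite eqn_leq n3' n3.
have xE : x = pi / 3 by rewrite /x nE.
rewrite xE cos_pi_third -xE in cx *.
(* The parabola bound at pi / 3, where the cosine is 1/2, itself yields this estimate of pi. *)
have x1 : 1 <= x ^+ 2 by lra.
have : 3 / 4 <= u by rewrite /u (_ : x ^+ 4 = (x ^+ 2) ^+ 2); [nra|ring].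
by move=> ?; nra.
Qed.

(** * Geometric bound for sums of even powers of cosines *)

Lemma sum_half_pow_le (R : realFieldType) (m : nat) :
  \sum_(0 <= j < m) (2^-1 : R) ^+ j <= 2.
Proof.
have -> : \sum_(0 <= j < m) (2^-1 : R) ^+ j = 2 - 2 * 2^-1 ^+ m.
  elim: m => [|m IH]; first by rewrite big_nil expr0; lra.
  by rewrite big_nat_recr//= IH exprS; field.
by rewrite gerBl mulr_ge0// exprn_ge0// invr_ge0.
Qed.

(** The Gaussian bound gives exp(- c j^2 pi^2) with c = k / n^2 >= 1. Since c (j^2 - 1) >= j - 1,
    this is at most exp(- c pi^2) exp(- pi^2)^(j - 1), and exp(- pi^2) <= 1/2. *)
Lemma cos_pow_le (R : realType) (n k j : nat) :
  (0 < j)%N -> (j.*2 <= n)%N -> (n ^ 2 <= k)%N ->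
  cos (j%:R * pi / n%:R) ^+ k.*2
    <= expR (- (k%:R * (pi ^+ 2 / n%:R ^+ 2))) * 2^-1 ^+ j.-1 :> R.
Proof.
move=> j0 j2n nk.
have n0 : (0 < n)%N by lia.
have rn0 : (0 : R) < n%:R by rewrite ltr0n.
have pi0 := pi_gt0 R.
set x : R := _ / _.
have x0 : 0 <= x by rewrite divr_ge0 ?mulr_ge0// ltW.
have xpi : x <= pi / 2.
  rewrite ler_pdivrMr//.
  have : j%:R * 2 <= n%:R :> R by rewrite -natrM ler_nat; lia.
  by move=> ?; nra.
have cx0 : 0 <= cos x by rewrite cos_ge0_pihalf// xpi andbT; lra.
have cx : cos x ^+ k.*2 <= expR (- (k%:R * x ^+ 2)).
  have -> : - (k%:R * x ^+ 2) = k.*2%:R * (- (x ^+ 2 / 2)).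
    by rewrite -muln2 natrM; field.
  rewrite expRM_natl lerXn2r ?nnegrE ?expR_ge0// cos_le_gauss// x0/=.
  by lra.
apply: (le_trans cx).
have e2 : expR (- pi ^+ 2) <= 2^-1 :> R.
  rewrite expRN lef_pV2 ?posrE ?expR_gt0//.
  apply: le_trans (expR_ge1Dx _).
  by have := pi_ge2 R; nra.
apply: (@le_trans _ _ (expR (- (k%:R * (pi ^+ 2 / n%:R ^+ 2))) *
   expR (- pi ^+ 2) ^+ j.-1)); last first.
  by rewrite ler_pM2l ?expR_gt0// lerXn2r ?nnegrE ?expR_ge0// invr_ge0.
rewrite -expRM_natl -expRD ler_expR.
have -> : x ^+ 2 = j%:R ^+ 2 * (pi ^+ 2 / n%:R ^+ 2).
  by rewrite /x; field; rewrite gt_eqF.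
have kn : (1 : R) <= k%:R / n%:R ^+ 2.
  by rewrite ler_pdivlMr ?exprn_gt0// mul1r -natrX ler_nat.
have -> : k%:R * (j%:R ^+ 2 * (pi ^+ 2 / n%:R ^+ 2)) =
  (k%:R / n%:R ^+ 2) * j%:R ^+ 2 * pi ^+ 2 :> R.
  by field; rewrite gt_eqF.
have -> : k%:R * (pi ^+ 2 / n%:R ^+ 2) = (k%:R / n%:R ^+ 2) * pi ^+ 2 :> R.
  by field; rewrite gt_eqF.
move: (k%:R / _) kn => c c1.
case: j j0 {j2n x x0 xpi cx0 cx} => // i _ /=.
rewrite -natr1.
have i0 : (0 : R) <= i%:R by [].
move: (i%:R) i0 => y y0.
rewrite -subr_ge0.
have -> : - (c * pi ^+ 2) + y * - pi ^+ 2 - - (c * (y + 1) ^+ 2 * pi ^+ 2)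
   = pi ^+ 2 * (c * y ^+ 2 + 2 * c * y - y) by ring.
by rewrite mulr_ge0 ?sqr_ge0//; nra.
Qed.

(** Even powers of the cosine have period pi. With evenness, this makes them depend on j only modulo
    n and up to sign, as the next two lemmas record. *)
Lemma cos_addnat_pi (R : realType) (n k j : nat) : (0 < n)%N ->
  cos ((j + n)%:R * pi / n%:R) ^+ k.*2 = cos (j%:R * pi / n%:R) ^+ k.*2 :> R.
Proof.
move=> n0.
have -> : (j + n)%:R * pi / n%:R = j%:R * pi / n%:R + pi :> R.
  by rewrite natrD; field; rewrite pnatr_eq0; lia.
by rewrite cosDpi -mul2n !exprM sqrrN.
Qed.

Lemma cos_modn_pi (R : realType) (n k j : nat) : (0 < n)%N ->
  cos ((j %% n)%:R * pi / n%:R) ^+ k.*2 = cos (j%:R * pi / n%:R) ^+ k.*2 :> R.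
Proof.
move=> n0; rewrite [in RHS](divn_eq j n) addnC.
elim: (j %/ n)%N => [|d IH]; first by rewrite addn0.
by rewrite mulSn addnCA addnC cos_addnat_pi.
Qed.

Lemma cos_subn_pi (R : realType) (n k j : nat) : (0 < n)%N -> (j <= n)%N ->
  cos ((n - j)%:R * pi / n%:R) ^+ k.*2 = cos (j%:R * pi / n%:R) ^+ k.*2 :> R.
Proof.
move=> n0 jn.
have -> : (n - j)%:R * pi / n%:R = - (j%:R * pi / n%:R) + pi :> R.
  by rewrite natrB//; field; rewrite pnatr_eq0; lia.
by rewrite cosDpi cosN -mul2n !exprM sqrrN.
Qed.

(** As n is odd, doubling permutes the nonzero residues, which turns the angles 2 l pi / n into j pi
    / n with 1 <= j < n. The symmetry between j and n - j reduces to j <= n / 2, and each half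
    contributes a geometric sum of at most 2 [q]. *)
Lemma sum_cos_pow_le (R : realType) (n k : nat) :
  (1 < n)%N -> odd n -> (n ^ 2 <= k)%N ->
  \sum_(l : 'Z_n | l != 0) cos (2 * (l : nat)%:R * pi / n%:R) ^+ k.*2
    <= 4 * expR (- (k%:R * (pi ^+ 2 / n%:R ^+ 2))) :> R.
Proof.
move=> n1 nodd nk; set q := expR _.
pose F (j : nat) : R := cos (j%:R * pi / n%:R) ^+ k.*2.
have n0 : (0 < n)%N by lia.
have u2 : (2%:R : 'Z_n) \is a GRing.unit by rewrite unitZpE// coprimen2.
have -> : \sum_(l : 'Z_n | l != 0) cos (2 * (l : nat)%:R * pi / n%:R) ^+ k.*2
    = \sum_(l : 'Z_n | l != 0) F l.
  rewrite [RHS](reindex (fun l : 'Z_n => l * 2%:R)); last first.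
    by exists (fun l => l / 2%:R) => l _; rewrite ?mulrK ?divrK.
  apply: eq_big => [l|l _].
    by rewrite mulrC mulrI_eq0//; exact: mulrI.
  rewrite /F.
  have -> : nat_of_ord (l * 2%:R) = ((2 * l) %% n)%N.
    by rewrite mulr_natr mulr2n /= [X in (_ %% X)%N]Zp_cast// mul2n addnn.
  by rewrite cos_modn_pi// natrM.
have -> : \sum_(l : 'Z_n | l != 0) F l = \sum_(1 <= j < n) F j.
  case: n n1 @F {nodd nk n0 u2 q} => [|[|m]] // _ F.
  by rewrite big_mkcond big_ord_recl/= add0r big_add1 big_mkord.
pose G (j : nat) : R := q * 2^-1 ^+ j.-1.
have G0 j : 0 <= G j by rewrite mulr_ge0 ?expR_ge0// exprn_ge0// invr_ge0.
have sG : \sum_(1 <= j < n) G j <= 2 * q.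
  rewrite -mulr_sumr mulrC ler_wpM2r ?expR_ge0//.
  by rewrite big_add1/= sum_half_pow_le.
(* Whichever of j and n - j is at most n / 2 supplies the bound; keeping both terms yields two
   copies of one sum. *)
apply: (@le_trans _ _ (\sum_(1 <= j < n) (G j + G (n - j)%N))).
  apply: ler_sum_nat => j /andP[j1 jn].
  have [h|h] := leqP j.*2 n.
    by rewrite -[leLHS]addr0 lerD// cos_pow_le.
  rewrite -[leLHS]add0r lerD// /F -cos_subn_pi 1?ltnW//.
  by apply: cos_pow_le => //; lia.
rewrite big_split/= (_ : \sum_(1 <= j < n) G (n - j)%N = \sum_(1 <= j < n) G j).
  by lra.
by rewrite [RHS]big_nat_rev/=; apply: eq_bigr => j _; rewrite add1n subSS.
Qed.

(** * The characters of Z_n and the one-dimensional representations *)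

Section EtaCharacter.
Variables (R : realType) (n : nat).
Hypothesis n1 : (1 < n)%N.
Implicit Types (i j l : 'Z_n).

Lemma eta_expE (m : nat) :
  eta R n ^+ m = (cos (m%:R * (2 * pi / n%:R)) +i* sin (m%:R * (2 * pi / n%:R)))%C.
Proof.
elim: m => [|m IH]; first by rewrite mul0r cos0 sin0.
rewrite exprS IH {1}/eta -[m.+1%:R]natr1; set t := _ / n%:R.
rewrite [(_ + 1) * t]mulrDl mul1r cosD sinD.
by apply/eqP; rewrite eq_complex /=; apply/andP; split; apply/eqP; ring.
Qed.

Lemma eta_expn : eta R n ^+ n = 1.
Proof.
rewrite eta_expE (_ : n%:R * (2 * pi / n%:R) = pi *+ 2); last first.
  by rewrite mulr2n; field; rewrite pnatr_eq0; lia.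
by rewrite cos2pi sin2pi.
Qed.

Lemma etaX0 : etaX R (0 : 'Z_n) = 1.
Proof. by rewrite /etaX expr0. Qed.

Lemma etaXD i j : etaX R (i + j) = etaX R i * etaX R j.
Proof.
rewrite /etaX -exprD -(expr_mod (i + j) eta_expn) /=.
by rewrite [X in (_ %% X)%N]Zp_cast.
Qed.

Lemma etaXNr i : etaX R i * etaX R (- i) = 1.
Proof. by rewrite -etaXD subrr etaX0. Qed.

Lemma etaX_norm i : `|etaX R i| = 1.
Proof. by rewrite /etaX eta_expE normc_def /= cos2Dsin2 sqrtr1. Qed.

Lemma etaX_conj i : (etaX R i)^* = etaX R (- i).
Proof.
have e0 : etaX R i != 0 by rewrite -normr_eq0 etaX_norm oner_eq0.
by apply: (mulfI e0); rewrite etaXNr -normCK etaX_norm expr1n.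
Qed.

(** Primitivity of [eta]: with x = i pi / n, the real part is 1 - 2 sin(x)^2, and sin x > 0 when 0 <
    i < n. *)
Lemma etaX_eq1 i : (etaX R i == 1) = (i == 0).
Proof.
apply/eqP/eqP => [|->]; last exact: etaX0.
rewrite /etaX eta_expE => -[c _]; apply: contra_eq c => i0.
have ipos : (0 < i)%N by rewrite lt0n; apply: contra i0 => /eqP i0; apply/eqP/val_inj.
have ilt : (i < n)%N by rewrite -[X in (_ < X)%N](Zp_cast n1).
set x : R := i%:R * pi / n%:R.
have -> : i%:R * (2 * pi / n%:R) = x *+ 2 by rewrite /x mulr2n; field; rewrite pnatr_eq0; lia.
rewrite cos_mulr2n cos2sin2.
have : 0 < sin x.
  apply: sin_gt0_pi; rewrite divr_gt0 ?mulr_gt0 ?pi_gt0 ?ltr0n//=; last by lia.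
  rewrite ltr_pdivrMr ?ltr0n; last by lia.
  by rewrite mulrC ltr_pM2l ?pi_gt0// ltr_nat.
by move=> s0; have := exprn_gt0 2 s0; rewrite neq_lt => ?; apply/orP; left; lra.
Qed.

(** Orthogonality of characters: translating l by 1 multiplies the sum by [etaX R j], which differs
    from 1 unless j = 0. *)
Lemma sum_etaX j : \sum_l etaX R (l * j) = n%:R * (j == 0)%:R.
Proof.
have [->|j0] := eqVneq j 0.
  rewrite mulr1 (eq_bigr (fun=> 1)) => [|l _]; last by rewrite mulr0 etaX0.
  by rewrite sumr_const card_ord Zp_cast.
rewrite mulr0; set S := \sum_l _.
have SE : S = S * etaX R j.
  rewrite {1}/S (reindex_inj (addIr 1)) mulr_suml; apply: eq_bigr => l _.
  by rewrite mulrDl mul1r etaXD.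
have : S * (1 - etaX R j) = 0 by rewrite mulrBr mulr1 -SE subrr.
by move/eqP; rewrite mulf_eq0 subr_eq0 [1 == _]eq_sym etaX_eq1 (negPf j0) orbF => /eqP.
Qed.

Lemma cos_etaX l :
  (cos (2 * (l : nat)%:R * pi / n%:R))%:C%C = (etaX R l + etaX R (- l)) / 2 :> R[i].
Proof.
set x := _ / _; have eE : etaX R l = (cos x +i* sin x)%C.
  by rewrite /etaX eta_expE (_ : _ * (_ / _) = x)// /x; ring.
have -> : etaX R (- l) = (cos x +i* - sin x)%C.
  have e0 : etaX R l != 0 by rewrite -normr_eq0 etaX_norm oner_eq0.
  apply: (mulfI e0); rewrite etaXNr eE; apply/eqP; rewrite eq_complex /=.
  rewrite mulrN opprK -!expr2 cos2Dsin2 eqxx/= mulrN addrC mulrC subrr.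
  by rewrite eqxx.
rewrite eE; apply: (canRL (mulfK _)); first by rewrite pnatr_eq0.
by apply/eqP; rewrite mulr_natr mulr2n eq_complex /= subrr addr0 !eqxx.
Qed.

End EtaCharacter.

(** * The involution, and the Haar state as a positive trace *)

Section StarAlgebra.
Variables (R : realType) (n : nat).
Implicit Types (x y z : KP R n).

Lemma KP_scalerAl (c : R[i]) x y : c *: x * y = c *: (x * y).
Proof.
congr pair; last exact/esym/scalemxAl.
by apply/ffunP => ij; rewrite !ffunE scalerAl.
Qed.

Lemma KP_scalerAr (c : R[i]) x y : x * (c *: y) = c *: (x * y).
Proof.
congr pair; last exact/esym/scalemxAr.
by apply/ffunP => ij; rewrite !ffunE; exact: mulrCA.
Qed.

Lemma KPstarD x y : KPstar (x + y) = KPstar x + KPstar y.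
Proof.
congr pair; first by apply/ffunP => ij; rewrite !ffunE rmorphD.
by rewrite /= map_mxD linearD.
Qed.

Lemma KPstar0 : KPstar (0 : KP R n) = 0.
Proof.
congr pair; first by apply/ffunP => ij; rewrite !ffunE rmorph0.
by rewrite /= map_mx0 trmx0.
Qed.

Lemma KPstarZ (c : R[i]) x : KPstar (c *: x) = c^* *: KPstar x.
Proof.
congr pair; first by apply/ffunP => ij; rewrite !ffunE rmorphM.
by rewrite /= map_mxZ linearZ.
Qed.

Lemma KPstarM x y : KPstar (x * y) = KPstar y * KPstar x.
Proof.
congr pair; first by apply/ffunP => ij; rewrite !ffunE rmorphM mulrC.
by rewrite /= map_mxM trmx_mul.
Qed.

Lemma KPstar1 : KPstar (1 : KP R n) = 1.
Proof.
congr pair; first by apply/ffunP => ij; rewrite !ffunE rmorph1.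
by rewrite /= map_mx1 trmx1.
Qed.

Lemma KPstar_sum (I : Type) (r : seq I) (P : pred I) (F : I -> KP R n) :
  KPstar (\sum_(i <- r | P i) F i) = \sum_(i <- r | P i) KPstar (F i).
Proof. exact: (big_morph (@KPstar R n) KPstarD KPstar0). Qed.

Lemma haarE x : haar x =
  (2 * n%:R ^+ 2)^-1 * (\sum_ij x.1 ij + n%:R * \tr x.2).
Proof.
rewrite /haar pair_bigA; congr (_ * (_ + _)).
by apply: eq_bigr => -[i j].
Qed.

Lemma haar_mulC x y : haar (x * y) = haar (y * x).
Proof.
rewrite !haarE; congr (_ * (_ + _ * _)); last exact: mxtrace_mulC.
by apply: eq_bigr => ij _; rewrite !ffunE mulrC.
Qed.

Lemma haar_star x : haar (KPstar x) = (haar x)^*.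
Proof.
rewrite !haarE rmorphM fmorphV rmorphM rmorphXn !rmorph_nat rmorphD.
rewrite rmorphM rmorph_nat rmorph_sum; congr (_ * (_ + _ * _)).
  by apply: eq_bigr => ij _; rewrite ffunE.
by rewrite mxtrace_tr trace_map_mx.
Qed.

Lemma haar_pos x : 0 <= haar (KPstar x * x).
Proof.
rewrite haarE mulr_ge0 ?invr_ge0 ?mulr_ge0 ?exprn_ge0//.
apply: addr_ge0.
  by apply: sumr_ge0 => ij _; rewrite !ffunE -normCKC exprn_ge0.
rewrite mulr_ge0//; apply: sumr_ge0 => i _.
rewrite mxE; apply: sumr_ge0 => j _.
by rewrite !mxE -normCKC exprn_ge0.
Qed.

End StarAlgebra.

(** * Products and convolutions of the one-dimensional representations *)

Section Characters.
Variables (R : realType) (n : nat).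
Hypothesis n1 : (1 < n)%N.
Implicit Types (i j l m : 'Z_n) (f g : 'Z_n -> R[i]) (x y : KP R n).

Lemma KPmul_ffun x y ij : (x * y).1 ij = x.1 ij * y.1 ij.
Proof. by rewrite ffunE. Qed.

Lemma KPmul_mx x y : (x * y).2 = x.2 *m y.2.
Proof. by []. Qed.

Lemma sum_Zn_const (c : R[i]) : \sum_(i : 'Z_n) c = n%:R * c.
Proof. by rewrite sumr_const card_ord Zp_cast// mulr_natl. Qed.

Lemma rho_plus_ffun l : (rho_plus R l).1 = [ffun ij => etaX R (ij.1 * l)].
Proof.
rewrite /rho_plus /= !raddf_sum /= [X in _ + X]big1 ?addr0//.
under eq_bigr do rewrite raddf_sum /=.
apply/ffunP => -[i j]; rewrite pair_bigA /= sum_ffunE (bigD1 (i, j))//= !ffunE.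
rewrite eqxx [_ *: _]mulr1 big1 ?addr0// => -[i' j'] ij.
by rewrite !ffunE /= eq_sym (negPf ij) scaler0.
Qed.

Lemma rho_plus_mx l : (rho_plus R l).2 = \matrix_(i, j) (j == i + l)%:R.
Proof.
rewrite /rho_plus /= !raddf_sum /= big1 ?add0r => [|i _]; last first.
  by rewrite raddf_sum /= big1// => j _; rewrite scaler0.
apply/matrixP => i j; rewrite summxE mxE (bigD1 i)//= mxE eqxx/= big1 ?addr0//.
by move=> i' ii'; rewrite mxE eq_sym (negPf ii').
Qed.

Lemma rho_plusM l m : rho_plus R l * rho_plus R m = rho_plus R (l + m).
Proof.
rewrite [LHS]surjective_pairing [RHS]surjective_pairing; congr pair.
  change ((rho_plus R l).1 * (rho_plus R m).1 = (rho_plus R (l + m)).1).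
  rewrite !rho_plus_ffun; apply/ffunP => ij.
  by rewrite !ffunE -etaXD// mulrDr.
change ((rho_plus R l).2 *m (rho_plus R m).2 = (rho_plus R (l + m)).2).
rewrite !rho_plus_mx; apply/matrixP => i j.
rewrite !mxE (bigD1 (i + l))//= !mxE eqxx mul1r addrA big1 ?addr0// => k kil.
by rewrite !mxE (negPf kil) mul0r.
Qed.

Lemma rho_plus0 : rho_plus R (0 : 'Z_n) = 1.
Proof.
rewrite [LHS]surjective_pairing; congr pair.
  by rewrite rho_plus_ffun; apply/ffunP => ij; rewrite !ffunE mulr0 etaX0.
by rewrite rho_plus_mx; apply/matrixP => i j; rewrite !mxE addr0 eq_sym.
Qed.

Lemma KPstar_rho_plus l : KPstar (rho_plus R l) = rho_plus R (- l).
Proof.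
rewrite [RHS]surjective_pairing; congr pair.
  rewrite !rho_plus_ffun; apply/ffunP => ij.
  by rewrite !ffunE etaX_conj// mulrN.
rewrite !rho_plus_mx; apply/matrixP => i j; rewrite !mxE rmorph_nat.
by rewrite -subr_eq eq_sym.
Qed.

Lemma natC_neq0 : n%:R != 0 :> R[i].
Proof. by rewrite pnatr_eq0 -lt0n ltnW. Qed.

Lemma haar_rho_plus l : haar (rho_plus R l) = (l == 0)%:R.
Proof.
rewrite /haar rho_plus_ffun rho_plus_mx.
under eq_bigr do under eq_bigr do rewrite ffunE/=.
under eq_bigr do rewrite sum_Zn_const.
rewrite -mulr_sumr sum_etaX//.
under [X in _ + n%:R * X]eq_bigr do
  rewrite mxE -[X in X == _]addr0 (inj_eq (addrI _)) eq_sym.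
rewrite sum_Zn_const; field.
exact: natC_neq0.
Qed.

Lemma fourier_rho_e l i j :
  fourier (rho_plus R l) (KPe R i j) = etaX R (i * l) / (2 * n%:R ^+ 2).
Proof.
rewrite /fourier haarE KPmul_mx mul0mx mxtrace0 mulr0 addr0.
rewrite (bigD1 (i, j))// KPmul_ffun rho_plus_ffun !ffunE eqxx mul1r.
rewrite big1 => [/=|ij nij]; first by rewrite addr0 mulrC.
by rewrite KPmul_ffun !ffunE (negPf nij) mul0r.
Qed.

Lemma fourier_rho_E l i j :
  fourier (rho_plus R l) (KPE R i j) = (i == j + l)%:R / (2 * n%:R).
Proof.
rewrite /fourier haarE KPmul_mx rho_plus_mx.
rewrite [X in X + _]big1 ?add0r => [|ij _].
  2: by rewrite KPmul_ffun ffunE mul0r.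
rewrite (_ : \tr _ = (i == j + l)%:R); first by field; exact: natC_neq0.
rewrite /mxtrace (bigD1 i)//= mxE (bigD1 j)//= !mxE !eqxx mul1r.
rewrite big1 => [|k kj]; last by rewrite !mxE (negPf kj) andbF mul0r.
rewrite big1 ?addr0// => k ki; rewrite mxE big1// => k' _.
by rewrite !mxE (negPf ki) mul0r.
Qed.

Lemma tensfD (phi psi : KPfun R n) s t :
  tensf phi psi (s + t) = tensf phi psi s + tensf phi psi t.
Proof. by rewrite /tensf -big_split; apply: eq_bigr => b _; rewrite ffunE mulrDl. Qed.

Lemma tensfZ (phi psi : KPfun R n) (c : R[i]) t :
  tensf phi psi (c *: t) = c * tensf phi psi t.
Proof. by rewrite /tensf mulr_sumr; apply: eq_bigr => b _; rewrite ffunE -mulrA. Qed.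

Lemma tensf_sum (phi psi : KPfun R n) (I : Type) (r : seq I) (P : pred I) F :
  tensf phi psi (\sum_(i <- r | P i) F i) = \sum_(i <- r | P i) tensf phi psi (F i).
Proof.
apply: (big_morph (tensf phi psi) (tensfD phi psi)).
by rewrite /tensf big1// => b _; rewrite ffunE mul0r.
Qed.

Lemma Delta_KPe i j : Delta (KPe R i j) = Delta_e R i j.
Proof.
rewrite /Delta [X in _ + X]big1 ?addr0 => [|i' _]; last first.
  by apply: big1 => j' _; rewrite mxE scale0r.
rewrite pair_bigA (bigD1 (i, j))//= ffunE eqxx scale1r big1 ?addr0// => -[i' j'] h.
by rewrite ffunE (negPf h) scale0r.
Qed.

Lemma Delta_KPE i j : Delta (KPE R i j) = Delta_E R i j.
Proof.
rewrite /Delta big1 ?add0r => [|i' _]; last first.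
  by apply: big1 => j' _; rewrite ffunE scale0r.
rewrite pair_bigA (bigD1 (i, j))//= mxE !eqxx scale1r big1 ?addr0// => -[i' j'] h.
by rewrite -pair_eqE/= in h; rewrite mxE (negPf h) scale0r.
Qed.

Lemma sum_pred1l (h : 'Z_n -> R[i]) i :
  \sum_j (j == i)%:R * h j = h i.
Proof.
rewrite (bigD1 i)//= eqxx mul1r big1 ?addr0// => j ji.
by rewrite (negPf ji) mul0r.
Qed.

(** Each half of the coproduct contributes half of the value. On the commutative block,
    orthogonality of characters forces l = m; on the matrix block the two indicators are compatible
    only if l = m. *)
Lemma conv_rho_e l m i j :
  Defs.conv (fourier (rho_plus R l)) (fourier (rho_plus R m)) (KPe R i j)
    = (l == m)%:R * fourier (rho_plus R l) (KPe R i j).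
Proof.
rewrite /Defs.conv Delta_KPe /Delta_e tensfD tensfZ !tensf_sum fourier_rho_e.
under [X in X + _]eq_bigr do rewrite tensf_sum.
under eq_bigr do under eq_bigr do rewrite tensf_tens /= !fourier_rho_e.
under [X in _ + _ * X]eq_bigr do rewrite tensf_sum.
under [X in _ + _ * X]eq_bigr do
  under eq_bigr do rewrite tensfZ tensf_tens /= !fourier_rho_E.
have -> : \sum_(s : 'Z_n) \sum_(t : 'Z_n)
    etaX R (s * l) / (2 * n%:R ^+ 2) * (etaX R ((i - s) * m) / (2 * n%:R ^+ 2))
  = (l == m)%:R * (etaX R (i * l) / (4 * n%:R ^+ 2)).
  under eq_bigr => s _.
    rewrite sum_Zn_const.
    rewrite (_ : _ * _ = etaX R (s * (l - m)) *
      (etaX R (i * m) / (4 * n%:R ^+ 3))); last first.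
      rewrite mulrBl mulrBr !etaXD//; field; exact: natC_neq0.
    over.
  rewrite -mulr_suml sum_etaX// subr_eq0.
  have [->|_] := eqVneq l m; first by field; exact: natC_neq0.
  by rewrite mulr0 !mul0r.
have -> : \sum_(p : 'Z_n) \sum_(r : 'Z_n) etaX R (i * (p - r)) *
    ((p == r + l)%:R / (2 * n%:R) * ((p + j == r + j + m)%:R / (2 * n%:R)))
  = (l == m)%:R * (etaX R (i * l) / (4 * n%:R)).
  rewrite exchange_big /=.
  under eq_bigr => r _.
    under eq_bigr => p _.
      rewrite (_ : _ * _ = (p == r + l)%:R * (etaX R (i * (p - r)) *
        ((p + j == r + j + m)%:R / (4 * n%:R ^+ 2)))); last first.
        by field; exact: natC_neq0.
      over.
    rewrite sum_pred1l [r + l + j]addrAC (inj_eq (addrI _)) [r + l]addrC addrK.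
    over.
  rewrite sum_Zn_const.
  by field; exact: natC_neq0.
by field; exact: natC_neq0.
Qed.

(** Again the two sums of the coproduct contribute equally. In each, one functional gives an
    indicator on i - j and the other a character sum over s, and together they force i = j + l and l
    = m. *)
Lemma conv_rho_E l m i j :
  Defs.conv (fourier (rho_plus R l)) (fourier (rho_plus R m)) (KPE R i j)
    = (l == m)%:R * fourier (rho_plus R l) (KPE R i j).
Proof.
rewrite /Defs.conv Delta_KPE /Delta_E tensfD !tensf_sum fourier_rho_E.
under [X in X + _]eq_bigr do rewrite tensf_sum.
under eq_bigr do under eq_bigr do rewrite tensfZ tensf_tens /= fourier_rho_e fourier_rho_E.
under [X in _ + X]eq_bigr do rewrite tensf_sum.
under [X in _ + X]eq_bigr do
  under eq_bigr do rewrite tensfZ tensf_tens /= fourier_rho_e fourier_rho_E.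
have shift t k : (i - t == j - t + k) = (i == j + k).
  by rewrite addrAC (inj_eq (addIr _)).
under eq_bigr do under eq_bigr do rewrite shift.
under [X in _ + X]eq_bigr do under eq_bigr do rewrite shift.
have -> : \sum_(s : 'Z_n) \sum_(t : 'Z_n) etaX R (s * (i - j)) *
    (etaX R (- s * l) / (2 * n%:R ^+ 2) * ((i == j + m)%:R / (2 * n%:R)))
  = (l == m)%:R * (i == j + l)%:R / (4 * n%:R).
  under eq_bigr => s _.
    rewrite sum_Zn_const.
    rewrite (_ : _ * _ = etaX R (s * (i - j - l)) *
      ((i == j + m)%:R / (4 * n%:R ^+ 2))); last first.
      rewrite [s * (i - j - l)]mulrDr mulrN -mulNr etaXD//; field; exact: natC_neq0.
    over.
  rewrite -mulr_suml sum_etaX// subr_eq0 subr_eq [l + j]addrC.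
  have [->|_] := eqVneq i (j + l); last by rewrite mulr0 !mul0r mulr0 mul0r.
  rewrite (inj_eq (addrI _)); field; exact: natC_neq0.
have -> : \sum_(s : 'Z_n) \sum_(t : 'Z_n) etaX R (s * (j - i)) *
    ((i == j + l)%:R / (2 * n%:R) * (etaX R (s * m) / (2 * n%:R ^+ 2)))
  = (l == m)%:R * (i == j + l)%:R / (4 * n%:R).
  under eq_bigr => s _.
    rewrite sum_Zn_const.
    rewrite (_ : _ * _ = etaX R (s * (j - i + m)) *
      ((i == j + l)%:R / (4 * n%:R ^+ 2))); last first.
      rewrite [s * (_ + m)]mulrDr [etaX R (_ + s * m)]etaXD//; field; exact: natC_neq0.
    over.
  rewrite -mulr_suml sum_etaX//.
  have [->|_] := eqVneq i (j + l); last by rewrite !mul0r !mulr0 mul0r.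
  rewrite opprD addrA subrr sub0r addrC subr_eq0 eq_sym.
  field; exact: natC_neq0.
by field; exact: natC_neq0.
Qed.

Lemma conv_rho_plus l m y :
  Defs.conv (fourier (rho_plus R l)) (fourier (rho_plus R m)) y
    = (l == m)%:R * fourier (rho_plus R l) y.
Proof.
rewrite (KP_expand y) !linear_sum mulr_sumr /=; apply: eq_bigr => b _.
rewrite !linearZ /= mulrCA; congr (_ * _).
by case: b => -[i j] /=; rewrite ?conv_rho_e ?conv_rho_E.
Qed.

End Characters.

(** * Combinations of the one-dimensional representations *)

Section CharacterSums.
Variables (R : realType) (n : nat).
Hypothesis n1 : (1 < n)%N.
Implicit Types (i j l m : 'Z_n) (f g : 'Z_n -> R[i]) (x y p b : KP R n).

(** These elements form a copy of the group algebra of Z_n: the product of the algebra convolves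
    coefficients, whereas convolution of the functionals multiplies them pointwise. *)
Definition rho_sum f : KP R n := \sum_l f l *: rho_plus R l.

Lemma rho_sumM f g :
  rho_sum f * rho_sum g = rho_sum (fun m => \sum_l f l * g (m - l)).
Proof.
rewrite /rho_sum mulr_suml.
under eq_bigr => l _.
  rewrite mulr_sumr (reindex_inj (addIr (- l))).
  under eq_bigr => m _ do
    rewrite KP_scalerAl KP_scalerAr scalerA rho_plusM// [l + _]addrC subrK.
  over.
by rewrite exchange_big; apply: eq_bigr => m _; rewrite scaler_suml.
Qed.

Lemma KPstar_rho_sum f :
  KPstar (rho_sum f) = rho_sum (fun l => (f (- l))^*).
Proof.
rewrite /rho_sum KPstar_sum (reindex_inj oppr_inj); apply: eq_bigr => l _.
by rewrite KPstarZ KPstar_rho_plus// opprK.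
Qed.

Lemma haar_rho_sum f : haar (rho_sum f) = f 0.
Proof.
rewrite /rho_sum linear_sum (bigD1 0)//= linearZ /= haar_rho_plus// eqxx mulr1.
by rewrite big1 ?addr0// => l l0; rewrite linearZ /= haar_rho_plus// (negPf l0) mulr0.
Qed.

Lemma fourier_rho_sum f y :
  fourier (rho_sum f) y = \sum_l f l * fourier (rho_plus R l) y.
Proof.
rewrite /fourier /rho_sum mulr_sumr linear_sum; apply: eq_bigr => l _.
by rewrite KP_scalerAr linearZ.
Qed.

Lemma conv_rho_sum f g y :
  Defs.conv (fourier (rho_sum f)) (fourier (rho_sum g)) y
    = fourier (rho_sum (fun l => f l * g l)) y.
Proof.
transitivity (\sum_l \sum_m (f l * g m) *
    Defs.conv (fourier (rho_plus R l)) (fourier (rho_plus R m)) y).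
  rewrite /Defs.conv /tensf /=.
  under eq_bigr do rewrite !fourier_rho_sum mulr_suml mulr_sumr.
  rewrite exchange_big; apply: eq_bigr => l _.
  under eq_bigr do rewrite mulr_sumr mulr_sumr.
  rewrite exchange_big; apply: eq_bigr => m _.
  by rewrite mulr_sumr; apply: eq_bigr => b _; ring.
rewrite fourier_rho_sum; apply: eq_bigr => l _.
rewrite (bigD1 l)//= big1 ?addr0 => [|m ml].
  by rewrite conv_rho_plus// eqxx mul1r.
by rewrite conv_rho_plus// eq_sym (negPf ml) mul0r mulr0.
Qed.

(** The exponent is [k.+1] because the zeroth convolution power is the counit, not the functional
    with all coefficients 1. *)
Lemma convX_rho_sum f (k : nat) y :
  convX (fourier (rho_sum f)) k.+1 y = fourier (rho_sum (fun l => f l ^+ k.+1)) y.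
Proof.
rewrite /convX iteropS; elim: k y => [|k IH] y /=.
  by [].
transitivity (Defs.conv (fourier (rho_sum f))
    (fourier (rho_sum (fun l => f l ^+ k.+1))) y).
  by rewrite /Defs.conv /tensf; apply: eq_bigr => b _ /=; rewrite IH.
by rewrite conv_rho_sum !fourier_rho_sum; apply: eq_bigr => l _; rewrite -exprS.
Qed.

(** The term l = 0 is the functional of [rho_plus R 0] = 1, that is, the Haar state, and it
    cancels. *)
Lemma convX_rho_sum_sub_haar f (k : nat) y : f 0 = 1 ->
  convX (fourier (rho_sum f)) k.+1 y - haar y
    = fourier (rho_sum (fun l => (l != 0)%:R * f l ^+ k.+1)) y.
Proof.
move=> f0; rewrite convX_rho_sum !fourier_rho_sum (bigD1 0)//= f0 expr1n mul1r.
rewrite {1}/fourier rho_plus0// mulr1 [X in X - _]addrC addrK.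
rewrite [RHS](bigD1 0)//= !mul0r add0r.
by apply: eq_bigr => l ->; rewrite mul1r.
Qed.

(* Cauchy-Schwarz for [p - 1/2] and [b]: expand
   [0 <= haar ((p - 1/2 + t b)^2)] at [t = s / (4 q)] with [s = 1] or [-1]. *)
Lemma fourier_projection_le b p (q : R) : 0 < q ->
  KPstar b = b -> haar b = 0 -> haar (b * b) <= (4 * q ^+ 2)%:C%C ->
  is_projection p -> `|fourier b p| <= q%:C%C.
Proof.
move=> q0 bstar hb hbb [pstar pp].
have pb : fourier b p = haar (p * b) by [].
have real_pb : haar (p * b) \is Num.real.
  by rewrite CrealE -haar_star KPstarM bstar pstar haar_mulC.
have pos (s : R[i]) : s \is Num.real -> s ^+ 2 = 1 ->
    0 <= q%:C%C + s * haar (p * b).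
  move=> sreal s2.
  set t := s / (4 * q)%:C%C.
  have q0' : q%:C%C != 0 :> R[i] by rewrite eq_complex /= gt_eqF.
  have tstar : t^* = t.
    apply: conj_Creal; rewrite rpredM// rpredV.
    by apply/complex_realP; exists (4 * q).
  pose z : KP R n := p - (2^-1 : R[i]) *: (1 : KP R n).
  have zstar : KPstar (z + t *: b) = z + t *: b.
    rewrite /z -scaleNr !KPstarD !KPstarZ KPstar1 pstar bstar tstar.
    by rewrite rmorphN fmorphV rmorph_nat.
  have := haar_pos (z + t *: b); rewrite zstar.
  (* Here (p - 1/2)^2 = 1/4 because p is idempotent, the cross terms in 1/2 and b vanish with
     [haar b], and traciality merges the other two. *)
  have -> : haar ((z + t *: b) * (z + t *: b))
      = 4^-1 + 2 * t * haar (p * b) + t ^+ 2 * haar (b * b).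
    have haarD x y : haar (x + y) = haar x + haar y by exact: raddfD.
    have haarZ (c : R[i]) x : haar (c *: x) = c * haar x by exact: linearZ.
    rewrite /z -scaleNr !(mulrDl, mulrDr, KP_scalerAl, KP_scalerAr, mul1r, mulr1).
    rewrite pp !(haarD, haarZ) hb -rho_plus0//.
    by rewrite haar_rho_plus// eqxx (haar_mulC b p) /=; field.
  move=> h0.
  have tE : t = s / 4 / q%:C%C.
    by rewrite /t rmorphM rmorph_nat invfM mulrA.
  have t2 : 0 <= t ^+ 2 by rewrite -realEsqr; apply/CrealP.
  have : 0 <= 4^-1 + 2 * t * haar (p * b) + t ^+ 2 * (4 * q ^+ 2)%:C%C.
    by apply: (le_trans h0); rewrite lerD2l ler_wpM2l.
  (* The choice of [t] makes the quadratic term 1/4 as well, so the expression is affine in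
     [haar (p * b)]. *)
  have -> : 4^-1 + 2 * t * haar (p * b) + t ^+ 2 * (4 * q ^+ 2)%:C%C
     = 2^-1 / q%:C%C * (q%:C%C + s * haar (p * b)).
    rewrite tE rmorphM rmorph_nat rmorphXn !exprMn s2; field.
    exact: q0'.
  by rewrite pmulr_rge0// mulr_gt0 ?invr_gt0 ?ltr0n// ltcR.
rewrite pb real_ler_norml//; apply/andP; split.
  have := pos 1 (rpred1 _) (expr1n _ _).
  by rewrite mul1r -lerBlDl sub0r.
have := pos (-1) (rpredN1 _); rewrite sqrrN expr1n => /(_ erefl).
by rewrite mulN1r subr_ge0.
Qed.

End CharacterSums.

(** * Spectral projections as witnesses for the lower bound *)

Section SpectralProjections.
Variables (R : realType) (n : nat).
Hypothesis n1 : (1 < n)%N.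
Implicit Types (A : pred 'Z_n) (i j l m : 'Z_n) (f : 'Z_n -> R[i]).

(* On the matrix block this is the sum over [A l] of the rank one projections
   onto the common eigenvectors of the circulant matrices (rho_l^+).2. *)
Definition spectral_projection A : KP R n :=
  ([ffun ij => (A ij.1)%:R],
   \matrix_(i, j) (n%:R^-1 * \sum_(l | A l) etaX R (l * (i - j)))).

Lemma spectral_projectionP A : is_projection (spectral_projection A).
Proof.
have n0 := natC_neq0 R n1.
split; congr pair.
- by apply/ffunP => ij; rewrite !ffunE rmorph_nat.
- apply/matrixP => i j; rewrite !mxE rmorphM fmorphV rmorph_nat rmorph_sum.
  congr (_ * _); apply: eq_bigr => l _.
  by rewrite /= etaX_conj// -mulrN opprB.
- by apply/ffunP => ij; rewrite !ffunE; case: (A _); rewrite ?mulr1 ?mulr0.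
set P := (X in _ = X); change (P *m P = P).
apply/matrixP => i j; rewrite !mxE.
(* Orthogonality in the inner sum over k leaves only l' = l. *)
transitivity (\sum_(l | A l) \sum_(l' | A l')
    (n%:R ^- 2 * etaX R (l * i - l' * j) * \sum_k etaX R (k * (l' - l)))).
  under eq_bigr => k _ do rewrite !mxE mulrACA mulr_suml mulr_sumr.
  rewrite exchange_big; apply: eq_bigr => l _.
  under eq_bigr do rewrite mulr_sumr mulr_sumr.
  rewrite exchange_big; apply: eq_bigr => l' _.
  rewrite mulr_sumr; apply: eq_bigr => k _.
  rewrite -expr2 exprVn -[RHS]mulrA -!etaXD//; congr (_ * etaX R _).
  by ring.
rewrite mulr_sumr; apply: eq_bigr => l Al.
rewrite (bigD1 l)//= sum_etaX// big1 => [|l' /andP[_ l'l]]; last first.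
  by rewrite sum_etaX// subr_eq0 (negPf l'l) !mulr0.
rewrite addr0 subrr eqxx -mulrBr /=; field.
exact: n0.
Qed.

(** Both blocks contribute equally: on the i-th rank one projection the shift of the matrix block
    has the same eigenvalue eta^(il) as the commutative block. *)
Lemma fourier_rho_spectral A l :
  fourier (rho_plus R l) (spectral_projection A)
    = n%:R^-1 * \sum_(i | A i) etaX R (i * l).
Proof.
have n0 := natC_neq0 R n1.
rewrite /fourier /haar.
have -> : \sum_(i : 'Z_n) (spectral_projection A * rho_plus R l).2 i i
    = \sum_(i | A i) etaX R (i * l).
  rewrite KPmul_mx rho_plus_mx//; under eq_bigr do rewrite mxE.
  rewrite exchange_big /=.
  transitivity (\sum_(k : 'Z_n) n%:R^-1 * \sum_(i | A i) etaX R (i * l)).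
    apply: eq_bigr => k _; rewrite (bigD1 (k + l))//= [X in _ + X]big1.
      rewrite !mxE eqxx mulr1 addr0.
      by congr (_ * _); apply: eq_bigr => i _; rewrite [k + l]addrC addrK.
    by move=> i ikl; rewrite !mxE (negPf ikl) mulr0.
  by rewrite sum_Zn_const// mulVKf.
have -> : \sum_(i : 'Z_n) \sum_(j : 'Z_n)
      (spectral_projection A * rho_plus R l).1 (i, j)
    = n%:R * \sum_(i | A i) etaX R (i * l).
  rewrite [\sum_(i | A i) _]big_mkcond mulr_sumr; apply: eq_bigr => i _.
  under eq_bigr do rewrite KPmul_ffun rho_plus_ffun// !ffunE /=.
  by rewrite sum_Zn_const//; case: (A i); rewrite ?mul1r ?mul0r.
by field; exact: n0.
Qed.

(** The Fourier transform [g] of f is real because f is real and even, and has mean zero because f 0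
    = 0. The projection onto [g] >= 0 picks up half the mean of |g|, which bounds half of each |f
    l0| by Fourier inversion. *)
Lemma exists_projection_ge f l0 : f 0 = 0 ->
  (forall l, f (- l) = f l) -> (forall l, f l \is Num.real) ->
  exists2 p, is_projection p & 2^-1 * `|f l0| <= `|fourier (rho_sum f) p|.
Proof.
move=> f0 fN freal.
have n0 := natC_neq0 R n1.
have ngt0 : 0 < n%:R :> R[i] by rewrite ltr0n ltnW.
pose g i := \sum_l f l * etaX R (i * l).
have greal i : g i \is Num.real.
  rewrite CrealE /g rmorph_sum (reindex_inj oppr_inj); apply/eqP.
  apply: eq_bigr => l _; rewrite rmorphM /= etaX_conj// fN mulrN opprK.
  by congr (_ * _); apply: conj_Creal.
pose A i := 0 <= g i.
exists (spectral_projection A); first exact: spectral_projectionP.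
have -> : fourier (rho_sum f) (spectral_projection A)
    = n%:R^-1 * \sum_(i | A i) g i.
  rewrite fourier_rho_sum// /g exchange_big mulr_sumr; apply: eq_bigr => l _.
  by rewrite fourier_rho_spectral mulrCA mulr_sumr.
have sumg : \sum_i g i = 0.
  rewrite /g exchange_big big1// => l _; rewrite -mulr_sumr sum_etaX//.
  by have [->|_] := eqVneq l 0; rewrite ?f0 ?mul0r ?mulr0.
have inv : \sum_i g i * etaX R (i * - l0) = n%:R * f l0.
  under eq_bigr do rewrite mulr_suml.
  rewrite exchange_big (bigD1 l0)//= [X in _ + X]big1 ?addr0 => [|l ll0].
    under eq_bigr do rewrite -mulrA -etaXD// -mulrDr.
    by rewrite -mulr_sumr sum_etaX// subrr eqxx mulr1 mulrC.
  under eq_bigr do rewrite -mulrA -etaXD// -mulrDr.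
  by rewrite -mulr_sumr sum_etaX// subr_eq0 (negPf ll0) !mulr0.
have posA : 0 <= \sum_(i | A i) g i by exact: sumr_ge0.
rewrite [leRHS]ger0_norm; last by rewrite mulr_ge0// invr_ge0 ltW.
rewrite ler_pdivlMl// -(ler_pM2l (_ : 0 < 2)) ?ltr0n//.
rewrite [leLHS](_ : _ = `|n%:R * f l0|); last first.
  by rewrite normrM normr_nat; field.
rewrite -inv; apply: (le_trans (ler_norm_sum _ _ _)).
under eq_bigr do rewrite normrM etaX_norm// mulr1.
rewrite (bigID A) /=.
rewrite (eq_bigr g) => [|i Ai]; last by rewrite ger0_norm.
rewrite [X in _ + X](eq_bigr (fun i => - g i)) => [|i Ai]; last first.
  by rewrite ltr0_norm// real_ltNge// ?real0// .
(* Mean zero makes the totals of the positive and negative parts of [g] equal. *)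
rewrite sumrN mulr_natl mulr2n lerD2l.
move/eqP: sumg; rewrite (bigID A) /= addrC addr_eq0 => /eqP ->.
by rewrite opprK.
Qed.

End SpectralProjections.

(** * The cosine walk *)

Section CosineWalk.
Variables (R : realType) (n : nat).
Hypothesis n1 : (1 < n)%N.
Implicit Types (k : nat) (l m : 'Z_n) (p : KP R n).

Definition walk_coef l : R[i] := (cos (2 * (l : nat)%:R * pi / n%:R))%:C%C.

Lemma walk_coefE l : walk_coef l = (etaX R l + etaX R (- l)) / 2.
Proof. exact: cos_etaX. Qed.

Lemma walk_coef0 : walk_coef 0 = 1.
Proof. by rewrite walk_coefE oppr0 etaX0; field. Qed.

Lemma walk_coefN l : walk_coef (- l) = walk_coef l.
Proof. by rewrite !walk_coefE opprK addrC. Qed.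

Lemma walk_coef_real l : walk_coef l \is Num.real.
Proof. by apply/complex_realP; eexists. Qed.

(** Each product is half of cos(2 m pi / n) plus terms in the characters eta^(2l) and eta^(-2l),
    which sum to zero over l since 2 is nonzero modulo n > 2. *)
Lemma sum_walk_coefM m : (2 < n)%N ->
  \sum_l walk_coef l * walk_coef (m - l) = n%:R / 2 * walk_coef m.
Proof.
move=> n2; have two0 : (2%:R == 0 :> 'Z_n) = false.
  apply/negbTE/eqP => /(congr1 (@nat_of_ord _)); rewrite val_Zp_nat// modn_small//.
pose chi (l : 'Z_n) := etaX R l.
have chiD := etaXD R n1.
transitivity (\sum_l (4^-1 * (chi m + chi (- m))
   + 4^-1 * chi (- m) * chi (l * 2%:R) + 4^-1 * chi m * chi (l * - 2%:R))).
  apply: eq_bigr => l _; rewrite !walk_coefE opprB.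
  have -> : l * 2%:R = l + l by ring.
  have -> : l * - 2%:R = - l - l by ring.
  rewrite /chi !chiD.
  have := etaXNr R n1 l; set u := etaX R l; set v := etaX R (- l) => uv.
  set x := etaX R m; set y := etaX R (- m).
  transitivity ((u * v * (x + y) + u * u * y + v * v * x) / 4); first by field.
  by rewrite uv; field.
rewrite !big_split /= sum_Zn_const// -!mulr_sumr !sum_etaX// oppr_eq0 two0.
by rewrite !mulr0 !addr0 walk_coefE /chi; field.
Qed.

Lemma KPstar_rho_sum_real (f : 'Z_n -> R[i]) :
  (forall l, f (- l) = f l) -> (forall l, f l \is Num.real) ->
  KPstar (rho_sum f) = rho_sum f.
Proof.
move=> fN freal; rewrite KPstar_rho_sum//; apply: eq_bigr => l _.
by rewrite fN conj_Creal.
Qed.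

Lemma walk_is_state : (2 < n)%N -> is_state (fourier (rho_sum walk_coef)).
Proof.
move=> n2; set a := rho_sum _.
have n0 := natC_neq0 R n1.
have astar : KPstar a = a.
  by apply: KPstar_rho_sum_real; [exact: walk_coefN|exact: walk_coef_real].
(* Thus [a] is n / 2 times a projection. *)
have aa : a = (2 / n%:R) *: (a * a).
  rewrite /a rho_sumM// /rho_sum scaler_sumr; apply: eq_bigr => l _.
  rewrite scalerA sum_walk_coefM//; congr (_ *: _).
  by field; exact: n0.
split=> [x|]; last by rewrite /= /fourier mul1r haar_rho_sum// walk_coef0.
change (0 <= fourier a (KPstar x * x)).
have -> : fourier a (KPstar x * x) = (2 / n%:R) * haar (KPstar (x * a) * (x * a)).
  rewrite /fourier {1}aa KP_scalerAr linearZ /= mulrA haar_mulC.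
  by rewrite KPstarM astar !mulrA.
by rewrite mulr_ge0 ?haar_pos// divr_ge0 ?ler0n.
Qed.

(* Belongs to the power [k.+1], as the zeroth power is the counit. *)
Definition centered_walk k l : R[i] := (l != 0)%:R * walk_coef l ^+ k.+1.

Lemma centered_walkN k l : centered_walk k (- l) = centered_walk k l.
Proof. by rewrite /centered_walk oppr_eq0 walk_coefN. Qed.

Lemma centered_walk_real k l : centered_walk k l \is Num.real.
Proof. by rewrite rpredM ?rpred_nat// rpredX// walk_coef_real. Qed.

Lemma centered_walk0 k : centered_walk k 0 = 0.
Proof. by rewrite /centered_walk eqxx mul0r. Qed.

Lemma qtv_walkE k :
  qtv (convX (fourier (rho_sum walk_coef)) k.+1) (@haar R n)
  = ereal_sup [set (complex.Re `|fourier (rho_sum (centered_walk k)) p|)%:E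
              | p in [set p | is_projection p]].
Proof.
rewrite /qtv; congr ereal_sup; apply: eq_imagel => p _ /=.
by rewrite (convX_rho_sum_sub_haar n1 k p walk_coef0).
Qed.

Lemma qtv_walk_ge k l : l != 0 ->
  ((2^-1 * `|cos (2 * (l : nat)%:R * pi / n%:R)| ^+ k.+1)%:E
   <= qtv (convX (fourier (rho_sum walk_coef)) k.+1) (@haar R n))%E.
Proof.
move=> l0; rewrite qtv_walkE.
have [p pp] := exists_projection_ge n1 l (centered_walk0 k) (centered_walkN k)
  (centered_walk_real k).
have -> : `|centered_walk k l| = (`|cos (2 * (l : nat)%:R * pi / n%:R)| ^+ k.+1)%:C%C.
  rewrite /centered_walk l0 mul1r normrX rmorphXn /=; congr (_ ^+ _).
  by rewrite normc_def /= expr0n /= addr0 sqrtr_sqr.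
have -> : 2^-1 = (2^-1 : R)%:C%C by rewrite fmorphV rmorph_nat.
rewrite -rmorphM lecE => /andP[_ h].
apply: le_trans (ereal_sup_ubound _); last by exists p.
by rewrite lee_fin.
Qed.

Lemma qtv_walk_le k (q : R) : 0 < q ->
  \sum_(l : 'Z_n | l != 0) cos (2 * (l : nat)%:R * pi / n%:R) ^+ (k.+1).*2
    <= 4 * q ^+ 2 ->
  (qtv (convX (fourier (rho_sum walk_coef)) k.+1) (@haar R n) <= q%:E)%E.
Proof.
move=> q0 hq; rewrite qtv_walkE; apply: ge_ereal_sup => _ [p pp <-].
rewrite lee_fin.
suff : `|fourier (rho_sum (centered_walk k)) p| <= q%:C%C.
  by rewrite lecE => /andP[].
apply: fourier_projection_le => //.
- by apply: KPstar_rho_sum_real; [exact: centered_walkN|exact: centered_walk_real].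
- by rewrite haar_rho_sum// centered_walk0.
(* The Haar state reads off the coefficient at 0 of the square, which is the sum of squared
   coefficients because these are even in l. *)
rewrite rho_sumM// haar_rho_sum//.
rewrite (bigD1 0)//= {1}centered_walk0 mul0r add0r.
apply: (@le_trans _ _ (\sum_(l : 'Z_n | l != 0)
   cos (2 * (l : nat)%:R * pi / n%:R) ^+ (k.+1).*2)%:C%C); last by rewrite lecR.
rewrite rmorph_sum; apply: ler_sum => l l0.
rewrite sub0r centered_walkN /centered_walk l0 !mul1r -exprD addnn.
by rewrite -rmorphXn.
Qed.

End CosineWalk.

(** * The extremal coefficient and the final estimates *)

Lemma odd_walk_coef (R : realType) (n : nat) : (1 < n)%N -> odd n ->
  exists2 l : 'Z_n, l != 0 & `|cos (2 * (l : nat)%:R * pi / n%:R)| = cos (pi / n%:R) :> R.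
Proof.
move=> n1 nodd.
have lE : nat_of_ord (n./2%:R : 'Z_n) = n./2 by rewrite val_Zp_nat// modn_small//; lia.
(* For odd n this is (n - 1) / 2, so that 2 l pi / n = pi - pi / n. *)
exists (n./2%:R).
  by apply/eqP => /(congr1 val)/=; rewrite lE; lia.
rewrite lE.
have n0 : (n%:R : R) != 0 by rewrite pnatr_eq0; lia.
have -> : 2 * n./2%:R * pi / n%:R = - (pi / n%:R) + pi :> R.
  have : 2 * n./2%:R = n%:R - 1 :> R.
    by rewrite -natrM -[in RHS](odd_double_half n) nodd natrD addrC addKr mul2n.
  by move=> ->; field.
rewrite cosDpi cosN normrN ger0_norm// cos_ge0_pihalf//.
have pi0 := pi_gt0 R.
have pin : 0 <= pi / n%:R :> R by rewrite divr_ge0// ltW.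
have : pi / n%:R <= pi / 2 :> R.
  by rewrite ler_pM2l// lef_pV2 ?posrE ?ltr0n// ?ler_nat//; lia.
by lra.
Qed.

Theorem theorem3p3 (R : realType) (n : nat) (hn3 : (3 <= n)%N) (hodd : odd n)
    (a : KP R n)
    (ha : a = \sum_(l : 'Z_n)
            (cos (2 * (l : nat)%:R * pi / n%:R))%:C%C *: rho_plus R l) :
  [/\ is_state (fourier a),
      forall (c : R) (k : nat), 0 <= c -> (0 < k)%N ->
        k%:R = expR c * n%:R ^+ 2 ->
        ((1 / 2 * expR (- (k%:R * (pi ^+ 2 / (2 * n%:R ^+ 2)
                                   + pi ^+ 4 / (4 * n%:R ^+ 4)))))%:E
         <= qtv (convX (fourier a) k) (@haar R n)
         <= (expR (- (k%:R * (pi ^+ 2 / (2 * n%:R ^+ 2)))))%:E)%E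
    & forall (c : R) (k : nat), 0 <= c -> (0 < k)%N ->
        k%:R = expR (- c) * n%:R ^+ 2 ->
        ((1 / 2 * expR (- (k%:R * (pi ^+ 2 / (2 * n%:R ^+ 2)
                                   + pi ^+ 4 / (4 * n%:R ^+ 4)))))%:E
         <= qtv (convX (fourier a) k) (@haar R n))%E].
Proof.
have n1 : (1 < n)%N by lia.
rewrite (_ : a = rho_sum (@walk_coef R n))//.
(* A single lower bound serves both regimes of k. *)
have lower (k : nat) : (0 < k)%N ->
    ((1 / 2 * expR (- (k%:R * (pi ^+ 2 / (2 * n%:R ^+ 2)
                               + pi ^+ 4 / (4 * n%:R ^+ 4)))))%:E
     <= qtv (convX (fourier (rho_sum (@walk_coef R n))) k) (@haar R n))%E.
  case: k => // k _; have [l l0 cl] := odd_walk_coef R n1 hodd.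
  apply: (le_trans _ (qtv_walk_ge R n1 k l0)); rewrite lee_fin cl div1r.
  rewrite ler_pM2l ?invr_gt0// -mulrN expRM_natl.
  have := cos_pi_div_ge R hn3; set e := expR _ => h.
  by rewrite lerXn2r ?nnegrE ?expR_ge0// (le_trans _ h)// expR_ge0.
split; [exact: walk_is_state| |by move=> c k _ k0 _; exact: lower].
move=> c k c0 k0 kE; apply/andP; split; first exact: lower.
case: k k0 kE => // k _ kE; apply: qtv_walk_le => //; first exact: expR_gt0.
(* From c >= 0; this is the range in which the cosine sum is geometric. *)
have nk : (n ^ 2 <= k.+1)%N.
  rewrite -(ler_nat R) natrX kE ler_peMl ?exprn_ge0//.
  by apply: le_trans (expR_ge1Dx c); rewrite lerDl.
apply: (le_trans (sum_cos_pow_le R n1 hodd nk)).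
(* The bound on the sum is exactly 4 q^2 for q = exp(- k pi^2 / (2 n^2)), with [k.+1] in place of
   k. *)
rewrite -expRM_natl ler_wpM2l// ler_expR le_eqVlt; apply/orP; left; apply/eqP.
by field; rewrite pnatr_eq0; lia.
Qed.
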